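(* Let $M$ be a $d\times d$ dilation matrix all of whose eigenvalues $\lambda_1,\ldots,\lambda_d$ are real. Suppose that the mask $\{c_q\}_{q\in\mathbb{Z}^d}$ has finite support and satisfies $\sum_{q\in\mathbb{Z}^d}c_q=1$. Let $\phi$ be the corresponding limit (scaling) function, let $\Omega:=\{q\in\mathbb{Z}^d:c_q\ne0\}$ and $Q:=\max_{q\in\Omega}|q|$. Then $M$ can be represented as $M=CGC^{-1}$, where $G$ is a Jordan matrix and $C$ is a unitary matrix, with $G$ and $C$ real, and $$\operatorname{supp}\phi\subset CP=\{Cx: x\in P\},$$ where $P\subset\mathbb{R}^d$ is the rectangular parallelepiped of all $x=(x_1,\ldots,x_d)$ satisfying the following conditions for every Jordan box of $G$: - if the box has size $1$, is located in row $p$ and has eigenvalue $\lambda_p$, then $|x_p|\le\dfrac{Q}{|\lambda_p|-1}$; - if the box has size $s\geq 2$, begins in row $p$ and has eigenvalue $\lambda_p$ with $|\lambda_p|\neq2$, then $|x_{p+k-1}|\le\dfrac{Q}{|\lambda_p|-2}\left(1-\dfrac{1}{(|\lambda_p|-1)^k}\right)$ for $k=1,\ldots,s$; - if the box has size $s\geq 2$, begins in row $p$ and has eigenvalue $\lambda_p$ with $|\lambda_p|=2$, then $|x_{p+k-1}|\le Qk$ for $k=1,\ldots,s$.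
   Context: A dilation matrix is a $d\times d$ integer matrix all of whose eigenvalues have modulus greater than $1$; put $m:=|\det M|$. $|\cdot|$ is the Euclidean norm on $\mathbb{R}^d$. A Jordan matrix is a block-diagonal matrix whose diagonal blocks are Jordan boxes; a Jordan box of size $s$ with eigenvalue $\lambda$ is the $s\times s$ matrix with $\lambda$ on the main diagonal, $1$ on the first subdiagonal (directly below the main diagonal) and $0$ elsewhere. A mask is a family of coefficients $\{c_q\}_{q\in\mathbb{Z}^d}$. $S'$ denotes the space of tempered distributions on $\mathbb{R}^d$. For a finitely supported mask with $\sum_q c_q=1$, the scaling equation $$\phi(x)=m\sum_{q\in\mathbb{Z}^d}c_q\,\phi(Mx-q),\qquad x\in\mathbb{R}^d$$ (understood in the sense of distributions) has a compactly supported solution $\phi\in S'$, unique up to a constant factor; $\phi$ denotes this solution normalized by $\widehat\phi(0)=1$, that is, $\widehat\phi(u)=\prod_{j=1}^\infty m_0((M^* )^{-j}u)$ with $m_0(u)=\sum_q c_q e^{-2\pi i(q,u)}$ and $M^*$ the adjoint of $M$. It is called the limit function (or scaling function), since it is the limit in $S'$ of $T_c^nF_0$ as $n\to\infty$, where $(T_cf)(x)=m\sum_q c_qf(Mx-q)$ is the cascade operator and $F_0$ is any piecewise continuous compactly supported function with $\sum_{q\in\mathbb{Z}^d}F_0(x+q)=1$, $\widehat F_0(0)=1$ and $\widehat F_0$ continuous at the origin. The support is that of a distribution.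
   Formalization: A real unitary C need not exist (e.g. M with rows (2,1),(0,3)); proved instead: M=CGC^{-1} with G real Jordan and C real invertible always exists, and supp φ ⊂ CP holds for every such representation in which C is unitary. *)

(* Defs.v *)
From HB Require Import structures.
From mathcomp Require Import all_boot all_order all_algebra.
From mathcomp Require Import complex.
From mathcomp Require Import all_classical all_reals all_analysis.
Import Order.TTheory GRing.Theory Num.Theory.
Import numFieldNormedType.Exports.

Set Implicit Arguments.
Unset Strict Implicit.
Unset Printing Implicit Defensive.

Local Open Scope classical_set_scope.
Local Open Scope ring_scope.
Local Open Scope complex_scope.

(** Vectors of R^d and Z^d are columns. The library
    norm of ['cV[R]_d] is the sup norm; it is used only through the topology. *)

Definition enorm (R : realType) (d : nat) (x : 'cV[R]_d) : R :=
  Num.sqrt (\sum_(i < d) x i 0 ^+ 2).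

Definition cmod (R : realType) (z : R[i]) : R := ComplexField.Normc.normc z.

(** ** Schwartz functions *)

Definition partial (R : realType) (d : nat) (i : 'I_d) (f : 'cV[R]_d -> R[i]) :
    'cV[R]_d -> R[i] :=
  fun x => ('D_(delta_mx i 0) (fun y => complex.Re (f y) : R^o) x)
       +i* ('D_(delta_mx i 0) (fun y => complex.Im (f y) : R^o) x).

Definition iter_partial (R : realType) (d : nat) (s : seq 'I_d)
    (f : 'cV[R]_d -> R[i]) : 'cV[R]_d -> R[i] :=
  foldr (@partial R d) f s.

Definition smooth (R : realType) (d : nat) (f : 'cV[R]_d -> R[i]) : Prop :=
  forall (s : seq 'I_d) (x : 'cV[R]_d),
    differentiable (fun y => complex.Re (iter_partial s f y) : R^o) x /\
    differentiable (fun y => complex.Im (iter_partial s f y) : R^o) x.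

Definition schwartz_weight (R : realType) (d : nat) (k : nat) (s : seq 'I_d)
    (f : 'cV[R]_d -> R[i]) (x : 'cV[R]_d) : R :=
  enorm x ^+ k * cmod (iter_partial s f x).

Definition schwartz (R : realType) (d : nat) (f : 'cV[R]_d -> R[i]) : Prop :=
  smooth f /\
  forall (k : nat) (s : seq 'I_d), has_ubound (range (schwartz_weight k s f)).

Definition schwartz_seminorm (R : realType) (d : nat) (k : nat) (s : seq 'I_d)
    (f : 'cV[R]_d -> R[i]) : R :=
  sup (range (schwartz_weight k s f)).

(** ** Tempered distributions *)

(** A distribution is a total function on functions, but only its values on
    Schwartz functions are ever constrained or used. The Schwartz space is
    metrizable, so continuity of a linear functional is sequential continuity
    at 0. *)
Definition tempered (R : realType) (d : nat)
    (phi : ('cV[R]_d -> R[i]) -> R[i]) : Prop :=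
  (forall (a : R[i]) (f g : 'cV[R]_d -> R[i]), schwartz f -> schwartz g ->
     phi (fun x => a * f x + g x) = a * phi f + phi g) /\
  (forall psi : nat -> 'cV[R]_d -> R[i],
     (forall n, schwartz (psi n)) ->
     (forall k s, schwartz_seminorm k s (psi n) @[n --> \oo] --> (0 : R)) ->
     cmod (phi (psi n)) @[n --> \oo] --> (0 : R)).

Definition fsupport (R : realType) (d : nat) (f : 'cV[R]_d -> R[i]) :
    set 'cV[R]_d :=
  closure [set x | f x != 0].

Definition test_function (R : realType) (d : nat) (f : 'cV[R]_d -> R[i]) :
    Prop :=
  smooth f /\ compact (fsupport f).

Definition vanishes_on (R : realType) (d : nat)
    (phi : ('cV[R]_d -> R[i]) -> R[i]) (U : set 'cV[R]_d) : Prop :=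
  forall f, test_function f -> fsupport f `<=` U -> phi f = 0.

Definition supp (R : realType) (d : nat)
    (phi : ('cV[R]_d -> R[i]) -> R[i]) : set 'cV[R]_d :=
  [set x | forall U : set 'cV[R]_d, open U -> U x -> ~ vanishes_on phi U].

Definition character (R : realType) (d : nat) (u x : 'cV[R]_d) : R[i] :=
  let t := 2 * pi * (u^T *m x) 0 0 in cos t -i* sin t.

(** The Fourier transform of a compactly supported [phi] is the function
    [u |-> <phi, chi * exp(-2 pi i (u, .))>], for any test function [chi] equal
    to 1 on a neighbourhood of [supp phi]. *)
Definition fourier_at (R : realType) (d : nat)
    (phi : ('cV[R]_d -> R[i]) -> R[i]) (u : 'cV[R]_d) (z : R[i]) : Prop :=
  exists (chi : 'cV[R]_d -> R[i]) (U : set 'cV[R]_d),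
    [/\ test_function chi, open U, supp phi `<=` U,
        (forall x, U x -> chi x = 1)
      & phi (fun x => chi x * character u x) = z].

(** ** Dilation matrices and the scaling equation *)

Definition intr_mx (R : realType) (m n : nat) (A : 'M[int]_(m, n)) :
    'M[R]_(m, n) :=
  map_mx intr A.

Definition dilation (R : realType) (d : nat) (M : 'M[int]_d) : Prop :=
  forall z : R[i], eigenvalue (map_mx intr M) z -> 1 < `|z|.

(** The distribution [x |-> phi (M x - q)]: the change of variables
    [y = M x - q] moves it onto the test function. *)
Definition dilate_shift (R : realType) (d : nat) (M : 'M[int]_d)
    (q : 'cV[int]_d) (phi : ('cV[R]_d -> R[i]) -> R[i]) :
    ('cV[R]_d -> R[i]) -> R[i] :=
  fun f => (`|\det M|%N%:R)^-1 *
           phi (fun y => f (invmx (intr_mx R M) *m (y + intr_mx R q))).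

Definition scaling_equation (R : realType) (d : nat) (M : 'M[int]_d)
    (c : 'cV[int]_d -> R[i]) (phi : ('cV[R]_d -> R[i]) -> R[i]) : Prop :=
  forall f, schwartz f ->
    phi f = `|\det M|%N%:R *
            \sum_(q \in [set: 'cV[int]_d]) (c q * dilate_shift M q phi f).

Definition limit_function (R : realType) (d : nat) (M : 'M[int]_d)
    (c : 'cV[int]_d -> R[i]) (phi : ('cV[R]_d -> R[i]) -> R[i]) : Prop :=
  [/\ tempered phi, compact (supp phi), scaling_equation M c phi
    & fourier_at phi 0 1].

Definition mask_support (R : realType) (d : nat) (c : 'cV[int]_d -> R[i]) :
    set 'cV[int]_d :=
  [set q | c q != 0].

(** A maximum as soon as the mask is nonzero and finitely supported. *)
Definition mask_radius (R : realType) (d : nat) (c : 'cV[int]_d -> R[i]) : R :=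
  sup [set enorm (intr_mx R q) | q in mask_support c].

(** ** Jordan matrices *)

Definition jordan_box (R : realType) (s : nat) (lam : R) : 'M[R]_s :=
  \matrix_(i, j) if i == j then lam else if i == j.+1 :> nat then 1 else 0.

(** [G] has [n] diagonal boxes, the [i]-th one of size [s i] and eigenvalue
    [lam i]. *)
Definition jordan_matrix (R : realType) (d n : nat) (s : 'I_n -> nat)
    (lam : 'I_n -> R) (G : 'M[R]_d) : Prop :=
  (forall i, (0 < s i)%N) /\
  exists e : (\sum_(i < n) s i)%N = d,
    G = castmx (e, e) (\mxdiag_(i < n) jordan_box (s i) (lam i)).

(** Rows are numbered from 0. *)
Definition box_row (n : nat) (s : 'I_n -> nat) (i : 'I_n) : nat :=
  (\sum_(j < n | (j < i)%N) s j)%N.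

Definition box_bound (R : realType) (Q : R) (s : nat) (lam : R) (k : nat) : R :=
  if s == 1%N then Q / (`|lam| - 1)
  else if `|lam| == 2 then Q * k%:R
  else Q / (`|lam| - 2) * (1 - 1 / (`|lam| - 1) ^+ k).

Definition parallelepiped (R : realType) (d n : nat) (Q : R) (s : 'I_n -> nat)
    (lam : 'I_n -> R) : set 'cV[R]_d :=
  [set x | forall (i : 'I_n) (k : nat) (r : 'I_d), (1 <= k <= s i)%N ->
     r = (box_row s i + k - 1)%N :> nat ->
     `|x r 0| <= box_bound Q (s i) (lam i) k].

(** [unitarymx] lives over a [numClosedFieldType]. Not every real matrix with
    real spectrum is unitarily similar to a Jordan matrix (the rows (2, 1) and
    (0, 3) give a diagonalizable matrix that is not normal), so unitarity is
    kept apart from [jordan_decomposition]. *)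
Definition real_unitary (R : realType) (d : nat) (C : 'M[R]_d) : Prop :=
  map_mx (fun a : R => a%:C) C \is unitarymx.

Definition jordan_decomposition (R : realType) (d n : nat) (A : 'M[R]_d)
    (C G : 'M[R]_d) (s : 'I_n -> nat) (lam : 'I_n -> R) : Prop :=
  [/\ C \in unitmx, jordan_matrix s lam G & A = C *m G *m invmx C].

(* Main.v *)
Require Import Defs.
From mathcomp Require Import all_boot all_order all_algebra.
From mathcomp Require Import zify ring lra.
From mathcomp Require Import complex.
From mathcomp Require Import all_classical all_reals all_analysis.
Import Order.TTheory GRing.Theory Num.Theory.
Import numFieldNormedType.Exports.

Set Implicit Arguments.
Unset Strict Implicit.
Unset Printing Implicit Defensive.

Local Open Scope classical_set_scope.
Local Open Scope ring_scope.
Local Open Scope complex_scope.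

(** Writing $T_q x = M x - q$, the scaling equation says that $\phi$ is a
    combination of the distributions $\phi \circ T_q$, for $q$ in the mask
    support $\Omega$. If no $T_q x$ lies in $\mathrm{supp}\,\phi$, then $\phi$
    vanishes near every $T_q x$; as $\Omega$ is finite, all the $\phi \circ T_q$
    vanish on one neighbourhood of $x$, hence so does $\phi$. So every point $x$
    of $K = \mathrm{supp}\,\phi$ has some $M x - q$ in $K$ ([supp_scaling]).

    In the coordinates $y = C^{-1} x$ this reads $G y - C^{-1} q \in C^{-1} K$,
    where the entries of $C^{-1} q$ are at most $|q| \le Q$ in absolute value,
    because $C$ is unitary. Let $B_r$ be the maximum of $|y_r|$ over the compact
    set $C^{-1} K$, attained at some point $y$. In a row that begins a box of
    eigenvalue $\lambda$, the matrix $G$ multiplies by $\lambda$, so that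
    $|\lambda| B_r \le B_r + Q$; in any other row it also adds the coordinate
    above, so that $|\lambda| B_r \le B_r + Q + B_{r-1}$ ([supp_coord_bound]).
    As $|\lambda| > 1$, these inequalities bound $B_r$ row by row, and the
    claimed bounds are the solution of the recursion with equality
    ([box_bound1], [box_boundS]).

    The existence of a real Jordan form ([jordan_form]) is a statement about any
    real matrix whose characteristic polynomial splits. One chain is split off
    at a time. Let the minimal polynomial of $A$ be $q (X - \lambda)^s$ with
    $q(\lambda) \ne 0$ and put $B = A - \lambda$. Since the minimal polynomial
    does not divide $q^2 (X - \lambda)^{s-1}$, there are a row $x$ and a column
    $y$ with $x\, q(A) B^{s-1} q(A)\, y \ne 0$. The row $v = x\, q(A)$ and the
    column $f = q(A)\, y$ are both killed by $B^s$, while $v B^{s-1} f \ne 0$.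
    The rows $v B^i$ then span an invariant subspace with an invariant
    complement, the common kernel of the columns $B^j f$, because the matrix of
    the $v B^{i+j} f$ is triangular with a nonzero constant on its diagonal. The
    Jordan form follows by induction on the dimension. *)

(** * Splitting one Jordan chain off a matrix *)

Lemma jordan_box_mulmxE (R : realType) s (lam : R) m (P : 'M[R]_(s, m)) i k :
  (jordan_box s lam *m P) i k =
  lam * P i k + \sum_(j < s | i == j.+1 :> nat) P j k.
Proof.
rewrite mxE (bigD1 i) //= mxE eqxx; congr (_ + _).
rewrite big_mkcond [RHS]big_mkcond; apply: eq_bigr => j _ /=.
rewrite mxE eq_sym; case: eqVneq => [->|_] /=; first by rewrite ifN //; lia.
by case: ifP; rewrite ?mul1r ?mul0r.
Qed.

Lemma mulmx_jordan_boxE (R : realType) s (lam : R) m (H : 'M[R]_(m, s)) k j :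
  (H *m jordan_box s lam) k j =
  H k j * lam + \sum_(i < s | i == j.+1 :> nat) H k i.
Proof.
rewrite mxE (bigD1 j) //= mxE eqxx; congr (_ + _).
rewrite big_mkcond [RHS]big_mkcond; apply: eq_bigr => i _ /=.
rewrite mxE; case: eqVneq => [->|_] /=; first by rewrite ifN //; lia.
by case: ifP; rewrite ?mulr1 ?mulr0.
Qed.

(** A basis counted in two blocks is only propositionally as long as the ambient
    dimension; this transports a similarity along that equality. *)
Lemma simmx_cast (F : fieldType) k n (e : k = n) (D : 'M[F]_(k, n)) :
  row_free D -> forall A B, D *m A = B *m D ->
  castmx (e, erefl n) D \in unitmx /\
  castmx (e, erefl n) D *m A = castmx (e, e) B *m castmx (e, erefl n) D.
Proof.
by subst k => Dfree A B DA; rewrite !castmx_id -row_free_unit.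
Qed.

Lemma char_poly_simmx (F : fieldType) n (A B D : 'M[F]_n) :
  D \in unitmx -> D *m A = B *m D -> char_poly A = char_poly B.
Proof.
move=> Du DA; pose D' := map_mx (@polyC F) D.
have D'0 : \det D' != 0.
  by rewrite det_map_mx polyC_eq0 -unitfE -unitmxE.
apply: (mulfI D'0); rewrite /char_poly -det_mulmx mulrC -det_mulmx.
congr (\det _); rewrite /char_poly_mx mulmxBr mulmxBl -scalar_mxC.
by rewrite -!map_mxM DA.
Qed.

Lemma char_poly_castmx (F : fieldType) k n (e : k = n) (B : 'M[F]_k) :
  char_poly (castmx (e, e) B) = char_poly B.
Proof. by subst k; rewrite castmx_id. Qed.

Section ChainSplitting.
Variables (R : realType) (n' : nat).
Local Notation n := n'.+1.
Variable A : 'M[R]_n.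
Implicit Types (s m : nat) (lam : R).

(** Boxes carry their ones below the diagonal and act on rows from the left, so
    the chain is listed backwards: multiplying row [i] by [A - lam] yields row
    [i - 1], and row 0 is killed. *)
Lemma row_chain s lam (v : 'rV[R]_n) (B := A - lam%:M) :
  v *m B ^+ s = 0 ->
  let P := \matrix_(i < s) (v *m B ^+ (s.-1 - i)) in P *m A = jordan_box s lam *m P.
Proof.
move=> vBs P; have AE : A = lam%:M + B by rewrite addrC subrK.
apply/matrixP => i k; rewrite jordan_box_mulmxE {1}AE mulmxDr mxE mul_mx_scalar.
rewrite [X in X + _]mxE; congr (_ + _).
transitivity ((v *m B ^+ (s - i)) 0 k).
  rewrite -[(s - i)%N]prednK ?subn_gt0 // exprSr -mulmxE mulmxA -subn1 subnAC subn1.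
  by rewrite !mxE; apply: eq_bigr => l _; rewrite !mxE.
case: i => [[|i] lti] /=; first by rewrite subn0 vBs big_pred0 ?mxE.
rewrite (big_pred1 (Ordinal (ltnW lti))) ?mxE; last first.
  by move=> j /=; rewrite eqSS eq_sym.
by rewrite -subn1 -subnDA.
Qed.

(** Columns carry the same box when the chain is listed forwards. *)
Lemma col_chain s lam (f : 'cV[R]_n) (B := A - lam%:M) :
  B ^+ s *m f = 0 ->
  let H := \matrix_(k < n, j < s) (B ^+ j *m f) k 0 in A *m H = H *m jordan_box s lam.
Proof.
move=> Bsf H; have AE : A = lam%:M + B by rewrite addrC subrK.
apply/matrixP => k j; rewrite mulmx_jordan_boxE {1}AE mulmxDl mxE mul_scalar_mx.
rewrite [X in X + _]mxE [lam * _]mulrC; congr (_ + _).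
transitivity ((B ^+ j.+1 *m f) k 0).
  rewrite exprS -mulmxE -mulmxA [LHS]mxE [RHS]mxE.
  by apply: eq_bigr => l _; rewrite [H l j]mxE.
case: (ltnP j.+1 s) => ltj.
  rewrite (big_pred1 (Ordinal ltj)) ?[H _ _]mxE //.
rewrite big1; last by move=> i /eqP e; have := ltn_ord i; lia.
have -> : j.+1 = s by have := ltn_ord j; lia.
by rewrite Bsf mxE.
Qed.

(** The Gram matrix [P *m H] has entries [v B^(s-1-i+j) f]: they vanish for
    [i < j] since [B^s] kills [v], and on the diagonal they all equal the nonzero
    number [v B^(s-1) f]. So [P] and [ker H] are in direct sum, and a dimension
    count shows that they fill the space; [A H = H J] makes [ker H] stable. *)
Lemma chain_split s lam (v : 'rV[R]_n) (f : 'cV[R]_n) (B := A - lam%:M) :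
  v *m B ^+ s = 0 -> B ^+ s *m f = 0 -> (v *m B ^+ s.-1 *m f) 0 0 != 0 ->
  exists m (e : (s + m)%N = n) (D : 'M[R]_n) (A' : 'M[R]_m),
    D \in unitmx /\
    D *m A = castmx (e, e) (block_mx (jordan_box s lam) 0 0 A') *m D.
Proof.
move=> vBs Bsf vf.
have := row_chain vBs; have := col_chain Bsf; cbv zeta.
set H := (X in A *m X = _) => AH; set P := (X in X *m A = _) => PA.
have PHE i j : (P *m H) i j = (v *m B ^+ (s.-1 - i + j) *m f) 0 0.
  rewrite exprD -mulmxE -!mulmxA mulmxA !mxE.
  by apply: eq_bigr => k _; rewrite !mxE.
have PHu : P *m H \in unitmx.
  rewrite unitmxE det_trig; last first.
    apply/is_trig_mxP => i j ltij; rewrite PHE.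
    have -> : (s.-1 - i + j = s + (j - i).-1)%N by have := ltn_ord j; lia.
    by rewrite exprD -mulmxE mulmxA vBs !mul0mx mxE.
  rewrite unitfE; apply/prodf_neq0 => i _; rewrite PHE subnK //.
  by have := ltn_ord i; lia.
have rkH : \rank H = s.
  apply/eqP; rewrite eqn_leq rank_leq_col /=.
  by rewrite -{1}(mxrank_unit PHu) mxrankM_maxr.
pose K := row_base (kermx H).
have KH : K *m H = 0 by apply/sub_kermxP; rewrite eq_row_base.
have e : (s + \rank (kermx H))%N = n.
  by rewrite mxrank_ker rkH subnKC // -rkH rank_leq_row.
have Kst : (K *m A <= K)%MS.
  rewrite eq_row_base; apply/sub_kermxP.
  by rewrite -mulmxA AH mulmxA KH mul0mx.
have KA : K *m A = conjmx K A *m K by rewrite /conjmx mulmxKpV.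
have : row_free (col_mx P K).
  apply: inj_row_free => x; rewrite -[x]hsubmxK mul_row_col => xPK.
  have x1 : lsubmx x = 0.
    have : (lsubmx x *m P + rsubmx x *m K) *m H = 0 by rewrite xPK mul0mx.
    rewrite mulmxDl -[_ *m K *m H]mulmxA -[_ *m P *m H]mulmxA KH mulmx0 addr0 => xPH.
    by rewrite -[LHS](mulmxK PHu) xPH mul0mx.
  move: xPK; rewrite x1 mul0mx add0r => x2.
  suff -> : rsubmx x = 0 by rewrite row_mx0.
  by apply: (row_free_inj (row_base_free (kermx H))); rewrite mul0mx.
move=> /(simmx_cast e)/(_ A (block_mx (jordan_box s lam) 0 0 (conjmx K A))).
case; first by rewrite mul_col_mx mul_block_col !mul0mx addr0 add0r PA -KA.
by move=> Du DA; exists _, e, (castmx (e, erefl) (col_mx P K)), (conjmx K A).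
Qed.

(** The chain exists because the minimal polynomial [q (X - lam)^s] does not
    divide [q^2 (X - lam)^(s-1)]. Using [q(A)] on both sides places the row and the
    column both in the generalized eigenspace of [lam]. The characteristic
    polynomial of the complementary block divides a split polynomial, which keeps
    the induction going. *)
Lemma split_chain :
  (exists l, char_poly A = \prod_(a <- l) ('X - a%:P)) ->
  exists s m lam (e : (s + m)%N = n) (D : 'M[R]_n) (A' : 'M[R]_m),
    [/\ (0 < s)%N, D \in unitmx,
        D *m A = castmx (e, e) (block_mx (jordan_box s lam) 0 0 A') *m D &
        exists l', char_poly A' = \prod_(a <- l') ('X - a%:P)].
Proof.
case=> l Al; have := mxminpoly_dvd_char A; rewrite Al => /dvdp_prod_XsubC[msk].
have := mxminpoly_monic A; have := mxminpoly_nonconstant A.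
have := size_mxminpoly A; set p := mxminpoly A => szp d_gt0 pmon pE.
have {pE}pE : p = \prod_(a <- mask msk l) ('X - a%:P).
  by apply/eqP; rewrite -eqp_monic // monic_prod_XsubC.
have [lam plam] : exists lam, root p lam.
  case E : (mask msk l) pE => [|lam r] pE; last first.
    by exists lam; rewrite pE root_prod_XsubC mem_head.
  by move: szp; rewrite pE big_nil size_poly1 => -[d0]; rewrite -d0 in d_gt0.
have [s [q]] := multiplicity_XsubC p lam.
rewrite monic_neq0 //= => qlam pq.
have s_gt0 : (0 < s)%N.
  by rewrite lt0n; apply: contra qlam => /eqP s0; rewrite pq s0 expr0 mulr1 in plam.
have hB k : horner_mx A (('X - lam%:P) ^+ k) = (A - lam%:M) ^+ k.
  by rewrite rmorphXn /= rmorphB /= horner_mx_X horner_mx_C.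
have : horner_mx A (q * ('X - lam%:P) ^+ s.-1 * q) != 0.
  rewrite -dvd_mxminpoly -/p pq -{1}(prednK s_gt0) exprSr mulrA.
  rewrite dvdp_mul2l; last first.
    rewrite mulf_neq0 ?expf_neq0 ?polyXsubC_eq0 //.
    by apply: contraNneq qlam => ->; rewrite root0.
  by rewrite dvdp_XsubCl.
set Z := horner_mx A _ => Z0.
have [i [j Zij]] : exists i j, Z i j != 0.
  have /matrix0Pn := Z0; exact.
have Zv : (delta_mx 0 i : 'rV[R]_n) *m Z *m (delta_mx j 0 : 'cV[R]_n) = (Z i j)%:M.
  by apply/rowP => k; rewrite -rowE -colE !mxE ord1 eqxx.
have ZE : Z = horner_mx A q *m (A - lam%:M) ^+ s.-1 *m horner_mx A q.
  by rewrite -hB !mulmxE -!rmorphM.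
have p0 : horner_mx A q *m (A - lam%:M) ^+ s = 0.
  by rewrite -hB mulmxE -rmorphM -pq; exact: mx_root_minpoly.
have p0' : (A - lam%:M) ^+ s *m horner_mx A q = 0.
  by rewrite -hB mulmxE -rmorphM mulrC -pq; exact: mx_root_minpoly.
have [|||m [e [D [A' [Du DA]]]]] :=
    @chain_split s lam (delta_mx 0 i *m horner_mx A q)
                       (horner_mx A q *m delta_mx j 0).
- by rewrite -mulmxA p0 mulmx0.
- by rewrite mulmxA p0' mul0mx.
- by rewrite mulmxA -2!(mulmxA (delta_mx 0 i)) -ZE Zv mxE eqxx.
exists s, m, lam, e, D, A'; split=> //.
have : char_poly A' %| \prod_(a <- l) ('X - a%:P).
  rewrite -Al (char_poly_simmx Du DA) char_poly_castmx /char_poly.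
  by rewrite char_block_diag_mx det_ublock dvdp_mull.
case/dvdp_prod_XsubC=> msk' E; exists (mask msk' l); apply/eqP.
by rewrite -eqp_monic ?char_poly_monic ?monic_prod_XsubC.
Qed.
End ChainSplitting.

(** * Real Jordan form *)

Lemma block_simmx (F : fieldType) k m n (e : (k + m)%N = n) (J : 'M[F]_k)
    (A C G : 'M[F]_m) : C \in unitmx -> A = C *m G *m invmx C ->
  exists2 E : 'M[F]_n, E \in unitmx &
    castmx (e, e) (block_mx J 0 0 A) *m E =
    E *m castmx (e, e) (block_mx J 0 0 G).
Proof.
move=> Cu ->; subst n; exists (block_mx 1%:M 0 0 C).
  by rewrite unitmxE det_ublock det1 mul1r -unitmxE.
by rewrite !castmx_id !mulmx_block !(mulmx0, mul0mx, mulmx1, mul1mx, addr0, add0r)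
  mulmxKV.
Qed.

Lemma jordan_matrix_cons (R : realType) m d n (s : 'I_n.+1 -> nat)
    (lam : 'I_n.+1 -> R) (e : (s ord0 + m)%N = d) (G : 'M[R]_m) :
  (0 < s ord0)%N ->
  jordan_matrix (fun i => s (lift ord0 i)) (fun i => lam (lift ord0 i)) G ->
  jordan_matrix s lam
    (castmx (e, e) (block_mx (jordan_box (s ord0) (lam ord0)) 0 0 G)).
Proof.
move=> s0 [s_gt0 [e1 ->]]; split.
  by move=> i; case: (unliftP ord0 i) => [j ->|->]; rewrite ?s_gt0.
subst m; have e' : (\sum_(i < n.+1) s i)%N = d by rewrite big_ord_recl.
exists e'; rewrite mxdiag_recl castmx_comp castmx_id.
by congr (castmx (_, _) _); exact: eq_irrelevance.
Qed.

(** The second equation is between functions, so that a family of boxes indexed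
    by the tail can be replaced by it in dependent types. *)
Lemma ord_fun_cons T n (t0 : T) (t : 'I_n -> T) :
  exists u : 'I_n.+1 -> T, u ord0 = t0 /\ (fun i => u (lift ord0 i)) = t.
Proof.
exists (fun i => oapp t t0 (unlift ord0 i)); rewrite unlift_none.
by split=> //; apply/funext => i; rewrite liftK.
Qed.

Lemma jordan_form (R : realType) d (A : 'M[R]_d) :
  (exists l, char_poly A = \prod_(a <- l) ('X - a%:P)) ->
  exists n (s : 'I_n -> nat) (lam : 'I_n -> R) (C G : 'M[R]_d),
    jordan_decomposition A C G s lam.
Proof.
have [N ltdN] := ubnP d; elim: N d A ltdN => // N IHN [|d] A ltdN Asplit.
  have e : (\sum_(i < 0) (fun=> 0) i)%N = 0%N by rewrite big_ord0.
  exists 0%N, (fun=> 0%N), (fun=> 0), 1%:M, 0; split.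
  - exact: unitmx1.
  - by split=> [[]//|]; exists e; apply/matrixP=> -[].
  - by apply/matrixP=> -[].
have [k [m [a [e [D [A' [k0 Du DA A'split]]]]]]] := split_chain Asplit.
have ltmN : (m < N)%N by rewrite -ltnS (leq_trans _ ltdN) // ltnS -e; lia.
have [n [s1 [lam1 [C1 [G1 [C1u G1J A'E]]]]]] := IHN _ _ ltmN A'split.
have [s [s0 s1E]] := ord_fun_cons k s1; have [lam [lam0 lam1E]] := ord_fun_cons a lam1.
subst k s1 a lam1.
(* The similarity of the small block, padded by the identity. *)
have [E Eu BE] := block_simmx e (jordan_box (s ord0) (lam ord0)) C1u A'E.
have Cu : invmx D *m E \in unitmx by rewrite unitmx_mul unitmx_inv Du.
exists n.+1, s, lam, (invmx D *m E),
  (castmx (e, e) (block_mx (jordan_box (s ord0) (lam ord0)) 0 0 G1)).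
split; [exact: Cu | exact: jordan_matrix_cons |].
apply: (canRL (mulmxK Cu)); rewrite -[RHS]mulmxA -BE !mulmxA.
congr (_ *m E); apply: (canLR (mulmxK Du)).
by rewrite -mulmxA -DA mulKmx.
Qed.

(** * Smooth functions under affine changes of variables *)

Lemma mulmx_continuous (R : realType) m n p (B : 'M[R]_(m, n)) :
  continuous (fun x : 'M[R]_(n, p) => B *m x).
Proof.
move=> x; apply/(@cvg_mx_entourageP _ _ _ _ (fmap_filter _ (nbhs_filter x))) => E entE.
apply: filter_forall => i; apply: filter_forall => j.
have ent : \forall y \near (B *m x) i j, (((B *m x) i j, y) \in E).
  have := @nbhs_entourage _ ((B *m x) i j) _ entE.
  by apply: filterS => y; rewrite /xsection /= inE.
have cont : continuous (fun y : 'M[R]_(n, p) => (B *m y) i j : R).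
  have coordc k : continuous (fun y : 'M[R]_(n, p) => B i k * y k j : R).
    move=> y; apply: (@continuous_comp 'M[R]_(n, p) R R (fun y => y k j)).
      exact: coord_continuous.
    exact: mulrl_continuous.
  have -> : (fun y : 'M[R]_(n, p) => (B *m y) i j : R) =
            (fun y => \sum_k B i k * y k j) by apply/funext => y; rewrite mxE.
  by apply: continuous_big => [|k _]; [exact: add_continuous|exact: coordc].
exact: cont ent.
Qed.

Lemma affine_continuous (R : realType) d (B : 'M[R]_d) (b : 'cV[R]_d) :
  continuous (fun x : 'cV[R]_d => B *m (x + b)).
Proof.
move=> x; apply: (@continuous_comp 'cV[R]_d 'cV[R]_d _ (fun y => y + b)).
  by apply: continuousD; [exact: cvg_id|exact: cst_continuous].
exact: mulmx_continuous.
Qed.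

Section Smooth.
Variables (R : realType) (d : nat).
Local Notation V := 'cV[R]_d.
Implicit Types (f g : V -> R[i]) (i : 'I_d) (s : seq 'I_d).

(** Coinduction principle, which trades inductions on iterated derivatives for an
    invariant preserved by a single one. *)
Lemma smooth_coind (P : (V -> R[i]) -> Prop) :
  (forall f, P f ->
    (forall x, differentiable (fun y => complex.Re (f y) : R^o) x /\
               differentiable (fun y => complex.Im (f y) : R^o) x) /\
    (forall i, P (partial i f))) ->
  forall f, P f -> smooth f.
Proof.
move=> HP f Pf s.
suff : P (iter_partial s f) by move=> /HP[+ _].
by elim: s => //= i s /HP[_]; apply.
Qed.

Lemma smooth_differentiable f : smooth f -> forall x,
  differentiable (fun y => complex.Re (f y) : R^o) x /\
  differentiable (fun y => complex.Im (f y) : R^o) x.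
Proof. by move=> /(_ [::]). Qed.

Lemma smooth_partial i f : smooth f -> smooth (partial i f).
Proof. by move=> sf s x; have := sf (rcons s i) x; rewrite /iter_partial foldr_rcons. Qed.

Lemma Re_lin (a : R) (z w : R[i]) :
  complex.Re (a%:C * z + w) = a * complex.Re z + complex.Re w.
Proof. by case: z w => [z1 z2] [w1 w2] /=; rewrite mul0r subr0. Qed.

Lemma Im_lin (a : R) (z w : R[i]) :
  complex.Im (a%:C * z + w) = a * complex.Im z + complex.Im w.
Proof. by case: z w => [z1 z2] [w1 w2] /=; rewrite mul0r addr0. Qed.

Lemma smooth0 : smooth (fun _ : V => 0 : R[i]).
Proof.
apply: (@smooth_coind (eq^~ (fun _ => 0))) => // f ->; split.
  by move=> x; split; exact: differentiable_cst.
by move=> i; apply/funext => x; rewrite /partial !derive_cst.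
Qed.

Lemma smooth_lin (a : R) f g :
  smooth f -> smooth g -> smooth (fun x => a%:C * f x + g x).
Proof.
move=> sf sg.
apply: (@smooth_coind (fun h => exists f g, [/\ smooth f, smooth g &
    h = fun x => a%:C * f x + g x])); last by exists f, g.
move=> _ {f g sf sg} [f [g [sf sg ->]]].
have ReE : (fun x => complex.Re (a%:C * f x + g x) : R^o) =
    a *: (fun x => complex.Re (f x) : R^o) + (fun x => complex.Re (g x) : R^o).
  by apply/funext => x; rewrite Re_lin.
have ImE : (fun x => complex.Im (a%:C * f x + g x) : R^o) =
    a *: (fun x => complex.Im (f x) : R^o) + (fun x => complex.Im (g x) : R^o).
  by apply/funext => x; rewrite Im_lin.
split=> [x|i].
  rewrite ReE ImE; have [fR fI] := smooth_differentiable sf x.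
  have [gR gI] := smooth_differentiable sg x.
  by split; apply: differentiableD => //; exact: differentiableZ.
exists (partial i f), (partial i g); split; try exact: smooth_partial.
apply/funext => x; have [fR fI] := smooth_differentiable sf x.
have [gR gI] := smooth_differentiable sg x.
rewrite /partial ReE ImE !deriveD ?deriveZ //;
  do ?by [exact: diff_derivable | apply: diff_derivable; exact: differentiableZ].
by apply/eqP; rewrite eq_complex Re_lin Im_lin !eqxx.
Qed.

Lemma smooth_sum (a : 'I_d -> R) (F : 'I_d -> V -> R[i]) s :
  (forall j, smooth (F j)) -> smooth (fun x => \sum_(j <- s) (a j)%:C * F j x).
Proof.
move=> sF; elim: s => [|j s IHs].
  by under eq_fun do rewrite big_nil; exact: smooth0.
by under eq_fun do rewrite big_cons; exact: smooth_lin.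
Qed.
End Smooth.

(** The two difference quotients are equal, whether or not they converge. *)
Lemma derive_affine (R : realType) d (B : 'M[R]_d) (b x v : 'cV[R]_d)
    (f : 'cV[R]_d -> R^o) :
  'D_v (fun y => f (B *m (y + b))) x = 'D_(B *m v) f (B *m (x + b)).
Proof.
suff E h : B *m (h *: v + x + b) = h *: (B *m v) + B *m (x + b).
  by rewrite /derive /=; under eq_fun do rewrite E.
by rewrite -addrA mulmxDr -scalemxAr.
Qed.

Lemma derive_coord (R : realType) d (f : 'cV[R]_d -> R^o) (x v : 'cV[R]_d) :
  differentiable f x ->
  'D_v f x = \sum_j v j 0 * 'D_(delta_mx j 0) f x.
Proof.
move=> df; rewrite deriveE // {1}[v]matrix_sum_delta.
rewrite linear_sum; apply: eq_bigr => j _.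
by rewrite big_ord1 linearZ /= -deriveE.
Qed.

Section SmoothComposition.
Variables (R : realType) (d : nat).
Local Notation V := 'cV[R]_d.
Implicit Types (f g : V -> R[i]) (i : 'I_d) (s : seq 'I_d).

Lemma differentiable_affine (B : 'M[R]_d) (b x : V) (f : V -> R^o) :
  differentiable f (B *m (x + b)) ->
  differentiable (fun y => f (B *m (y + b))) x.
Proof.
move=> df; apply: (@differentiable_comp _ _ _ _ (fun y => B *m (y + b)) f) => //.
have -> : (fun y : V => B *m (y + b)) = (mulmx B : V -> V) + cst (B *m b).
  by apply/funext => y; rewrite mulmxDr.
apply: differentiableD; last exact: differentiable_cst.
exact: linear_differentiable (@mulmx_continuous _ _ _ _ B).
Qed.

Lemma partial_affine (B : 'M[R]_d) (b : V) f i : smooth f ->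
  partial i (fun y => f (B *m (y + b))) =
  (fun y => \sum_j (B j i)%:C * partial j f (B *m (y + b))).
Proof.
move=> sf; apply/funext => x.
have [fR fI] := smooth_differentiable sf (B *m (x + b)).
rewrite /partial (derive_affine _ _ _ _ (fun y => complex.Re (f y))).
rewrite (derive_affine _ _ _ _ (fun y => complex.Im (f y))).
rewrite (derive_coord _ fR) (derive_coord _ fI) -colE.
elim/big_rec3 : _ => [|j z y1 y2 _ <-] //=.
by apply/eqP; rewrite eq_complex Re_lin Im_lin /= !mxE !eqxx.
Qed.

(** The class of all [f \o affine] is not visibly stable under [partial], but the
    chain rule writes [partial i (f \o affine)] as [g \o affine] for a linear
    combination [g] of the [partial j f], which is again smooth. *)
Lemma smooth_affine (B : 'M[R]_d) (b : V) f :
  smooth f -> smooth (fun y => f (B *m (y + b))).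
Proof.
move=> sf; apply: (@smooth_coind _ _ (fun h => exists2 f, smooth f &
    h = fun y => f (B *m (y + b)))); last by exists f.
move=> _ {sf}[{}f sf ->]; split=> [x|i].
  have [fR fI] := smooth_differentiable sf (B *m (x + b)).
  split; [exact: (@differentiable_affine _ _ _ (fun y => complex.Re (f y)))|].
  exact: (@differentiable_affine _ _ _ (fun y => complex.Im (f y))).
exists (fun x => \sum_j (B j i)%:C * partial j f x); last exact: partial_affine.
by apply: smooth_sum => j; exact: smooth_partial.
Qed.

Lemma fsupport_affine (B : 'M[R]_d) (b : V) f (x : V) :
  fsupport (fun y => f (B *m (y + b))) x -> fsupport f (B *m (x + b)).
Proof.
move=> fx U nU; have := affine_continuous nU.
by move=> /fx[y /= [fy Uy]]; exists (B *m (y + b)).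
Qed.

Lemma test_function_affine (B : 'M[R]_d) (b : V) f : B \in unitmx ->
  test_function f -> test_function (fun y => f (B *m (y + b))).
Proof.
move=> Bu [sf cf]; split; first exact: smooth_affine.
apply: (@subclosed_compact _ _
  [set (invmx B *m (z + - (B *m b))) | z in fsupport f]).
- exact: closed_closure.
- apply: continuous_compact cf; apply: continuous_subspaceT.
  exact: affine_continuous.
- move=> x /fsupport_affine fx; exists (B *m (x + b)) => //.
  by rewrite -mulmxBr addrK mulKmx.
Qed.

Lemma iter_partial_eq0 f s (x : V) : ~ fsupport f x -> iter_partial s f x = 0.
Proof.
elim: s x => [|i s IHs] x /= fx.
  apply/eqP; apply: contra_notT fx => fx; exact: subset_closure.
have near0 : \forall y \near x, iter_partial s f y = 0.
  have : nbhs x (~` fsupport f).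
    by apply: open_nbhs_nbhs; split=> //; exact/closed_openC/closed_closure.
  by apply: filterS => y; exact: IHs.
have Re0 : 'D_(delta_mx i 0) (fun y => complex.Re (iter_partial s f y) : R^o) x = 0.
  rewrite (near_eq_derive (g := cst (0 : R^o))) ?derive_cst //.
  by apply: filterS near0 => y ->.
have Im0 : 'D_(delta_mx i 0) (fun y => complex.Im (iter_partial s f y) : R^o) x = 0.
  rewrite (near_eq_derive (g := cst (0 : R^o))) ?derive_cst //.
  by apply: filterS near0 => y ->.
by rewrite /partial Re0 Im0.
Qed.

Lemma enorm_continuous : continuous (@enorm R d).
Proof.
have coordc k : continuous (fun y : V => y k 0 ^+ 2 : R).
  move=> y; apply: (@continuous_comp V R R (fun y => y k 0) (fun z => z ^+ 2)).
    exact: coord_continuous.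
  exact: exprn_continuous.
have sumc : continuous (fun x : V => \sum_(i < d) x i 0 ^+ 2 : R).
  by apply: continuous_big => [|k _]; [exact: add_continuous|exact: coordc].
move=> x; apply: (@continuous_comp V R R (fun x => \sum_(i < d) x i 0 ^+ 2)).
  exact: sumc.
exact: sqrt_continuous.
Qed.

Lemma cmod_smooth_continuous f s : smooth f ->
  continuous (fun x => cmod (iter_partial s f x)).
Proof.
move=> sf x; have [fR fI] := sf s x.
have -> : (fun x => cmod (iter_partial s f x)) = (fun x => Num.sqrt
    (complex.Re (iter_partial s f x) ^+ 2 + complex.Im (iter_partial s f x) ^+ 2)).
  by apply/funext => y; rewrite /cmod; case: (iter_partial s f y).
apply: (@continuous_comp V R R _ Num.sqrt); last exact: sqrt_continuous.
apply: continuousD.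
  apply: (@continuous_comp V R R _ (fun z => z ^+ 2)); last exact: exprn_continuous.
  exact: differentiable_continuous fR.
apply: (@continuous_comp V R R _ (fun z => z ^+ 2)); last exact: exprn_continuous.
exact: differentiable_continuous fI.
Qed.

(** The scaling equation is tested on Schwartz functions, the support on test
    functions: the weights are continuous on the compact support and vanish
    outside. *)
Lemma test_function_schwartz f : test_function f -> schwartz f.
Proof.
move=> [sf cf]; split=> // k s.
have wc : continuous (schwartz_weight k s f).
  move=> x; apply: (continuousM (s := fun x => enorm x ^+ k)
    (t := fun x => cmod (iter_partial s f x))); last first.
    exact: cmod_smooth_continuous.
  apply: (@continuous_comp V R R _ (fun z => z ^+ k)); last exact: exprn_continuous.
  exact: enorm_continuous.
have [N [_ wN]] := compact_bounded
  (continuous_compact (continuous_subspaceT wc) cf).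
exists (Num.max 0 (N + 1)) => _ [x _ <-]; rewrite le_max.
have [fx|fx] := pselect (fsupport f x); last first.
  by rewrite /schwartz_weight iter_partial_eq0 // /cmod ComplexField.Normc.normc0 mulr0 lexx.
apply/orP; right; apply: le_trans (ler_norm _) _.
by apply: wN; [rewrite ltrDl|exists x].
Qed.
End SmoothComposition.

(** * The support and the scaling equation *)

Lemma filter_forall_seq (T : Type) (I : eqType) (F : set_system T) (s : seq I)
    (P : I -> T -> Prop) : Filter F ->
  (forall i, i \in s -> \forall x \near F, P i x) ->
  \forall x \near F, forall i, i \in s -> P i x.
Proof.
move=> FF; elim: s => [|i s IHs] Ps; first by apply: nearW.
have Pi := Ps i (mem_head _ _).
have {}IHs : \forall x \near F, forall j, j \in s -> P j x.
  by apply: IHs => j js; apply: Ps; rewrite inE js orbT.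
apply: filterS2 Pi IHs => x Pix Psx j.
by rewrite inE => /orP[/eqP ->|/Psx].
Qed.

(** The test function [f] enters the term of index [q] as the function
    [y |-> f (M^-1 (y + q))], whose support is the image of that of [f] under
    [x |-> M x - q]. If the support of [f] is close to [x], this image lies where
    [phi] vanishes. *)
Lemma supp_scaling (R : realType) d (M : 'M[int]_d) (c : 'cV[int]_d -> R[i])
    (phi : ('cV[R]_d -> R[i]) -> R[i]) (x : 'cV[R]_d) :
  intr_mx R M \in unitmx -> finite_set (mask_support c) ->
  scaling_equation M c phi -> supp phi x ->
  exists2 q, mask_support c q & supp phi (intr_mx R M *m x - intr_mx R q).
Proof.
move=> Mu cfin phiE phix; apply: contrapT => noq.
have /choice[U Uq] : forall q, exists U : set 'cV[R]_d, mask_support c q ->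
    [/\ open U, U (intr_mx R M *m x - intr_mx R q) & vanishes_on phi U].
  move=> q; have [cq|] := pselect (mask_support c q); last by exists set0.
  apply: contrapT => /forallNP noU; apply: noq; exists q => // U oU Ux vU.
  by apply: (noU U).
have [s sE] := (finite_seqP (mask_support c)).1 cfin.
(* Finiteness of the mask makes W a neighbourhood of x. *)
pose W := [set y | forall q, q \in s -> U q (intr_mx R M *m y - intr_mx R q)].
have nW : nbhs x W.
  apply: (@filter_forall_seq _ _ (nbhs x) s
    (fun q y => U q (intr_mx R M *m y - intr_mx R q)) (nbhs_filter x)) => q qs.
  have [oU Ux _] := Uq q (eq_ind_r (@^~ q) qs sE).
  have : continuous (fun y : 'cV[R]_d => intr_mx R M *m y - intr_mx R q).
    move=> y; apply: continuousD; last exact: cst_continuous.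
    exact: mulmx_continuous.
  by apply; apply: open_nbhs_nbhs.
apply: (phix W° _ nW); first exact: open_interior.
move=> f tf fW; rewrite phiE; last exact: test_function_schwartz.
rewrite fsbig1 ?mulr0 // => q _.
have [->|cq] := eqVneq (c q) 0; first by rewrite mul0r.
have [_ _ vU] := Uq q cq.
rewrite /dilate_shift vU ?mulr0 //.
  by apply: test_function_affine; rewrite ?unitmx_inv.
move=> y /fsupport_affine /fW /interior_subset /(_ q).
rewrite mulKVmx // addrK; apply.
by have : mask_support c q by []; rewrite sE.
Qed.

(** * Spectrum of a dilation matrix *)

Lemma map_intr_mx (R : realType) m n (A : 'M[int]_(m, n)) :
  map_mx (real_complex R) (intr_mx R A) = map_mx intr A.
Proof. by apply/matrixP => i j; rewrite !mxE rmorph_int. Qed.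

Lemma char_poly_split (R : realType) d (M : 'M[int]_d) :
  (forall z : R[i], eigenvalue (map_mx intr M) z -> z \is Num.real) ->
  exists l, char_poly (intr_mx R M) = \prod_(a <- l) ('X - a%:P).
Proof.
move=> Mreal; set Mc := map_mx intr M : 'M[R[i]]_d in Mreal.
have [r] := closed_field_poly_normal (char_poly Mc).
rewrite (monicP (char_poly_monic _)) scale1r => rE.
exists (map (fun z => complex.Re z) r); apply: (map_poly_inj (real_complex R)).
rewrite map_char_poly map_intr_mx -/Mc rE rmorph_prod big_map; apply: eq_big_seq => z zr /=.
rewrite rmorphB /= map_polyX map_polyC /= RRe_real //.
by apply: Mreal; rewrite eigenvalue_root_char rE root_prod_XsubC.
Qed.

Lemma dilation_unitmx (R : realType) d (M : 'M[int]_d) :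
  dilation R M -> intr_mx R M \in unitmx.
Proof.
move=> Mdil; rewrite -(map_unitmx (real_complex R)) -row_free_unit -kermx_eq0.
rewrite map_intr_mx; apply: contraT => ker0; have := Mdil 0.
by rewrite normr0 ltr10 /eigenvalue /eigenspace raddf0 subr0 => /(_ ker0).
Qed.

Lemma dilation_eigenvalue (R : realType) d (M : 'M[int]_d) (a : R) :
  dilation R M -> eigenvalue (intr_mx R M) a -> 1 < `|a|.
Proof.
move=> Mdil /eigenvalueP[v vM v0].
suff /Mdil : eigenvalue (map_mx intr M) a%:C.
  by rewrite normc_def /= expr0n addr0 sqrtr_sqr ltcE /= => /andP[].
apply/eigenvalueP; exists (map_mx (real_complex R) v); last by rewrite map_mx_eq0.
by rewrite -map_intr_mx -map_mxM vM map_mxZ.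
Qed.

(** * Bounds along a Jordan box *)

(** The sum ranges over the predecessor of [j] in the box: it is empty in the
    first row and has one term in the others. *)
Lemma jordan_matrix_rows (R : realType) d n (s : 'I_n -> nat) (lam : 'I_n -> R)
    (G : 'M[R]_d) : jordan_matrix s lam G ->
  forall i, exists row_of : 'I_(s i) -> 'I_d,
    (forall j, row_of j = (box_row s i + j)%N :> nat) /\
    forall (y : 'cV[R]_d) j, (G *m y) (row_of j) 0 =
      lam i * y (row_of j) 0 +
      \sum_(j' < s i | j == j'.+1 :> nat) y (row_of j') 0.
Proof.
case=> _ [e ->] i; exists (fun j => cast_ord e (tagnat.Rank i j)).
split=> [j|y j]; first exact: tagnat.RankEsum.
subst d; rewrite castmx_id cast_ord_id.
have rowE (z : 'cV[R]_(\sum_i s i)) k :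
    z (tagnat.Rank i k) 0 = (submxcol z i) k 0 by rewrite !mxE.
rewrite -[in LHS](submxcolK y) mul_mxdiag_mxcol [LHS]rowE mxcolK.
rewrite jordan_box_mulmxE rowE; congr (_ + _).
by apply: eq_bigr => k _; rewrite cast_ord_id rowE.
Qed.

(** [C^-1] is the transpose of [C] and preserves the Euclidean norm. *)
Lemma unitary_coord_le (R : realType) d (C : 'M[R]_d) (v : 'cV[R]_d) r :
  real_unitary C -> `|(invmx C *m v) r 0| <= enorm v.
Proof.
move=> /unitarymxP CCt.
have {}CCt : C *m C^T = 1%:M.
  apply: (map_mx_inj (f := real_complex R)); rewrite map_mxM map_mx1 -CCt.
  congr (_ *m _); apply/matrixP => i j; rewrite !mxE.
  by rewrite conj_Creal // complex_real.
have CtE : invmx C = C^T.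
  have [Cu _] := mulmx1_unit CCt.
  by rewrite -[LHS]mulmx1 -CCt mulKmx.
set w := invmx C *m v.
have -> : enorm v = enorm w.
  have dotE (u : 'cV[R]_d) : \sum_(i < d) u i 0 ^+ 2 = (u^T *m u) 0 0.
    by rewrite mxE; apply: eq_bigr => i _; rewrite mxE expr2.
  by rewrite /enorm !dotE /w CtE trmx_mul trmxK mulmxA -[v^T *m _ *m _]mulmxA CCt mulmx1.
rewrite -sqrtr_sqr ler_sqrt; last by apply: sumr_ge0 => i _; exact: sqr_ge0.
by rewrite (bigD1 r) //= lerDl; apply: sumr_ge0 => i _; exact: sqr_ge0.
Qed.

Lemma mask_radius_ge (R : realType) d (c : 'cV[int]_d -> R[i]) q :
  finite_set (mask_support c) -> mask_support c q ->
  enorm (intr_mx R q) <= mask_radius c.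
Proof.
move=> /finite_seqP[s sE] cq; apply: ub_le_sup; last by exists q.
rewrite sE; exists (\sum_(q <- s) enorm (intr_mx R q)) => _ [q' /= q's <-].
rewrite (big_rem q') //= lerDl; apply: sumr_ge0 => j _; exact: sqrtr_ge0.
Qed.

Lemma box_bound1 (R : realType) (Q lam : R) s :
  1 < `|lam| -> (`|lam| - 1) * box_bound Q s lam 1 = Q.
Proof.
move=> lam1; have l0 : `|lam| - 1 != 0 by rewrite subr_eq0 gt_eqF.
rewrite /box_bound; case: eqP => _; first by field.
case: eqP => [->|/eqP l2]; first by ring.
by field; rewrite l0 subr_eq0 l2.
Qed.

(** Boxes of size 1 follow a formula of their own, valid for [k = 1] only. *)
Lemma box_boundS (R : realType) (Q lam : R) s k :
  1 < `|lam| -> s != 1%N ->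
  (`|lam| - 1) * box_bound Q s lam k.+1 = Q + box_bound Q s lam k.
Proof.
move=> lam1 s1; have l0 : `|lam| - 1 != 0 by rewrite subr_eq0 gt_eqF.
rewrite /box_bound (negPf s1); case: eqP => [->|/eqP l2].
  by rewrite -natr1; ring.
by rewrite exprS; field; rewrite l0 subr_eq0 l2 expf_neq0.
Qed.

(** The first row of the box is [lam] times a unit row vector, since the ones lie
    below the diagonal; conjugating it back gives a row eigenvector. *)
Lemma jordan_eigenvalue (R : realType) d n (A C G : 'M[R]_d)
    (s : 'I_n -> nat) (lam : 'I_n -> R) i :
  jordan_decomposition A C G s lam -> eigenvalue A (lam i).
Proof.
move=> [Cu GJ ->]; have [s_gt0 _] := GJ.
have [row_of [_ GyE]] := jordan_matrix_rows GJ i.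
pose r := row_of (Ordinal (s_gt0 i)).
have rG : row r G = lam i *: delta_mx 0 r.
  apply/rowP => k; have := GyE (delta_mx k 0) (Ordinal (s_gt0 i)).
  by rewrite big_pred0 // addr0 -colE !mxE eqxx andbT eq_sym.
apply/eigenvalueP; exists (delta_mx 0 r *m invmx C).
  by rewrite -!mulmxA mulKmx // mulmxA -(rowE r G) rG scalemxAl.
apply/eqP => /(congr1 (mulmx^~ C)); rewrite mulmxKV // mul0mx.
by move=> /matrixP/(_ 0 r)/eqP; rewrite !mxE !eqxx oner_eq0.
Qed.

(** At a point [x0] of the support where the coordinate [r] of [C^-1 x] is largest
    in absolute value, the image [M x0 - q] in the support has a coordinate at
    most as large. It differs from [l] times the old one by at most
    [B + mask_radius c]; here [B] accounts for the entry of [G] below the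
    diagonal. *)
Lemma supp_coord_bound (R : realType) d (M : 'M[int]_d)
    (c : 'cV[int]_d -> R[i]) (phi : ('cV[R]_d -> R[i]) -> R[i])
    (C G : 'M[R]_d) (r : 'I_d) (l B : R) :
  intr_mx R M \in unitmx -> finite_set (mask_support c) ->
  compact (supp phi) -> scaling_equation M c phi ->
  C \in unitmx -> real_unitary C -> intr_mx R M = C *m G *m invmx C ->
  1 < `|l| ->
  (forall x, supp phi x ->
     `|(G *m (invmx C *m x)) r 0 - l * (invmx C *m x) r 0| <= B) ->
  forall x, supp phi x ->
    (`|l| - 1) * `|(invmx C *m x) r 0| <= mask_radius c + B.
Proof.
move=> Mu cfin Kc phiE Cu Cun ME l1 hB x Kx.
have coordc : continuous (fun x : 'cV[R]_d => `|(invmx C *m x) r 0|).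
  move=> y; apply: (@continuous_comp 'cV[R]_d R R
    (fun x => (invmx C *m x) r 0) Num.norm); last exact: norm_continuous.
  apply: (@continuous_comp 'cV[R]_d 'cV[R]_d R (mulmx (invmx C)) (fun y => y r 0)).
    exact: mulmx_continuous.
  exact: coord_continuous.
have [] := @compact_EVT_max _ _ _ (supp phi) _ Kc (continuous_subspaceT coordc).
  by exists x.
move=> x0 /set_mem Kx0 x0max.
have [q cq Kq] := supp_scaling Mu cfin phiE Kx0.
have := x0max _ (mem_set Kq); have := x0max _ (mem_set Kx).
have := hB _ Kx0; have := unitary_coord_le (intr_mx R q) r Cun.
have := mask_radius_ge cfin cq.
rewrite ME mulmxBr -!mulmxA mulKmx //; set y := invmx C *m x0; set w := invmx C *m intr_mx R q.
have -> : (G *m y - w) r 0 = (G *m y) r 0 - w r 0 by rewrite !mxE.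
move: ((G *m y) r 0) (y r 0) (w r 0) ((invmx C *m x) r 0) => g a b e.
move=> qQ bq gB ea gba.
have tri : `|l| * `|a| <= `|g - l * a| + `|g - b| + `|b|.
  rewrite -normrM -[`|g - l * a|]normrN.
  rewrite {1}(_ : l * a = - (g - l * a) + (g - b) + b); last by ring.
  apply: le_trans (ler_normD _ _) _; rewrite lerD2r; exact: ler_normD.
have lea : (`|l| - 1) * `|e| <= (`|l| - 1) * `|a|.
  by rewrite ler_wpM2l // subr_ge0 ltW.
lra.
Qed.

(** * The support bound *)

Theorem theorem7 (R : realType) (d : nat) (M : 'M[int]_d)
    (c : 'cV[int]_d -> R[i]) (phi : ('cV[R]_d -> R[i]) -> R[i])
    (d_gt0 : (0 < d)%N)
    (M_dilation : dilation R M)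
    (M_real : forall z : R[i], eigenvalue (map_mx intr M) z -> z \is Num.real)
    (c_finite : finite_set (mask_support c))
    (c_sum1 : \sum_(q \in [set: 'cV[int]_d]) c q = 1)
    (phi_limit : limit_function M c phi) :
  (exists (n : nat) (s : 'I_n -> nat) (lam : 'I_n -> R) (C G : 'M[R]_d),
     jordan_decomposition (intr_mx R M) C G s lam) /\
  (forall (n : nat) (s : 'I_n -> nat) (lam : 'I_n -> R) (C G : 'M[R]_d),
     jordan_decomposition (intr_mx R M) C G s lam -> real_unitary C ->
     supp phi `<=`
       [set C *m x | x in parallelepiped (mask_radius c) s lam]).
Proof.
have [_ Kc phiE _] := phi_limit; have Mu := dilation_unitmx M_dilation.
split; first by apply: jordan_form; exact: char_poly_split.
move=> n s lam C G decomp Cun x Kx.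
have [Cu GJ ME] := decomp; have [s_gt0 _] := GJ.
exists (invmx C *m x); last by rewrite mulKVmx.
move=> i; have lam1 := dilation_eigenvalue M_dilation (jordan_eigenvalue i decomp).
have [row_of [row_ofE GyE]] := jordan_matrix_rows GJ i.
have lam_gt0 : 0 < `|lam i| - 1 by rewrite subr_gt0.
(* The parallelepiped numbers the rows of a box from 1, hence the shift k.+1. *)
suff bound k (ltk : (k < s i)%N) y : supp phi y ->
    `|(invmx C *m y) (row_of (Ordinal ltk)) 0| <=
    box_bound (mask_radius c) (s i) (lam i) k.+1.
  case=> // k r ltk rE.
  have -> : r = row_of (Ordinal ltk).
    by apply: val_inj; rewrite /= row_ofE rE /= addnS subn1.
  exact: bound.
elim: k ltk y => [|k IHk] ltk y Ky; rewrite -(ler_pM2l lam_gt0).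
  rewrite box_bound1 // -[leRHS]addr0.
  apply: (supp_coord_bound Mu c_finite Kc phiE Cu Cun ME lam1) Ky => z Kz.
  by rewrite GyE big_pred0 // addr0 subrr normr0.
rewrite box_boundS //; last by rewrite gtn_eqF // (leq_ltn_trans _ ltk).
apply: (supp_coord_bound Mu c_finite Kc phiE Cu Cun ME lam1) Ky => z Kz.
rewrite GyE (big_pred1 (Ordinal (ltnW ltk))); last by move=> j; rewrite /= eqSS eq_sym.
by rewrite addrC addKr; exact: IHk.
Qed.
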